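(* For any $p,q\in S^6$ there exists $g\in G_2$ with $g(p)=q$, and every such $g$ is an algebra isomorphism $\mathbb{V}_{7,p}\to\mathbb{V}_{7,q}$. In particular, all algebras $\mathbb{V}_{7,p}$, $p\in S^6$, are mutually isomorphic.
   Context: Let $\{e_1,\dots,e_7\}$ be the standard orthonormal basis of $\mathbb{R}^7$ with Euclidean inner product $\langle\cdot,\cdot\rangle$, dual basis $\omega^1,\dots,\omega^7$, and $\omega^{ijk}=\omega^i\wedge\omega^j\wedge\omega^k$. Let $$\Phi=\omega^{123}+\omega^{145}+\omega^{167}+\omega^{246}-\omega^{257}-\omega^{347}-\omega^{356},$$ and let $\times$ be the bilinear cross product on $\mathbb{R}^7$ characterized by $\langle u\times v,w\rangle=\Phi(u,v,w)$. $S^6$ is the unit sphere of $\mathbb{R}^7$. For $p\in S^6$, the directional Vidinli algebra $\mathbb{V}_{7,p}=(\mathbb{R}^7,\veebar_p)$ has the bilinear product $$a\veebar_p b=\langle a,p\rangle b+\langle b,p\rangle a-\langle a,b\rangle p+\langle p,a\times b\rangle p .$$ $G_2\subset SO(7)$ denotes the automorphism group of the octonions acting on the imaginary octonions identified with $(\mathbb{R}^7,\times)$; equivalently, the group of all $g\in GL(7,\mathbb{R})$ with $\Phi(gu,gv,gw)=\Phi(u,v,w)$ for all $u,v,w\in\mathbb{R}^7$. *)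

(* Defs.v *)
From HB Require Import structures.
From mathcomp Require Import all_boot all_order all_algebra.
From mathcomp Require Import reals ring.

Set Implicit Arguments.
Unset Strict Implicit.
Unset Printing Implicit Defensive.

Import Order.TTheory GRing.Theory Num.Theory.
Local Open Scope ring_scope.

Section G2Vidinli.
Variable R : realType.
Implicit Types (u v w a b p : 'cV[R]_7) (g : 'M[R]_7).

Definition dot u v : R := \sum_i u i 0 * v i 0.

(* The covector omega^i, with i ranging over 1, ..., 7 while 'I_7 starts at 0. *)
Definition omega (i : nat) u : R := u (inord i.-1) 0.

(* omega^i /\ omega^j /\ omega^k, normalized (without the factor 1/3!) so that
   its value on (e_i, e_j, e_k) is 1. *)
Definition omega3 (i j k : nat) u v w : R :=
  \det (\matrix_(r < 3, c < 3)
    omega (tnth [tuple i; j; k] r) (tnth [tuple u; v; w] c)).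

Definition Phi u v w : R :=
  omega3 1 2 3 u v w + omega3 1 4 5 u v w + omega3 1 6 7 u v w
  + omega3 2 4 6 u v w - omega3 2 5 7 u v w - omega3 3 4 7 u v w
  - omega3 3 5 6 u v w.

(* The vector representing the linear form Phi u v; see dot_cross and
   cross_unique. *)
Definition cross u v : 'cV[R]_7 := \col_k Phi u v (delta_mx k 0).

Definition S6 p : Prop := dot p p = 1.

Definition vidinli p a b : 'cV[R]_7 :=
  dot a p *: b + dot b p *: a - dot a b *: p + dot p (cross a b) *: p.

Definition G2 g : Prop :=
  g \in unitmx /\
  forall u v w, Phi (g *m u) (g *m v) (g *m w) = Phi u v w.

Lemma omega3E i j k u v w : omega3 i j k u v w =
  omega i u * (omega j v * omega k w - omega k v * omega j w)
  - omega j u * (omega i v * omega k w - omega k v * omega i w)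
  + omega k u * (omega i v * omega j w - omega j v * omega i w).
Proof.
rewrite /omega3 (expand_det_col _ 0) !big_ord_recl big_ord0 /cofactor.
rewrite !(expand_det_col _ 0) !big_ord_recl !big_ord0 /cofactor !det_mx11 !mxE.
rewrite !(tnth_nth 0%N) !(tnth_nth u) /= /bump /=.
ring.
Qed.

Lemma Phi_linear u v : linear (Phi u v : _ -> R^o).
Proof.
move=> c w x; rewrite /Phi !omega3E /omega !mxE /GRing.scale /=.
ring.
Qed.

HB.instance Definition _ u v :=
  GRing.isLinear.Build R 'cV[R]_7 R^o _ (Phi u v) (Phi_linear u v).

Lemma dot_cross u v w : dot (cross u v) w = Phi u v w.
Proof.
rewrite [in RHS](matrix_sum_delta w) linear_sum /dot.
apply: eq_bigr => k _.
by rewrite big_ord1 linearZ /= mxE mulrC.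
Qed.

Lemma cross_unique u v x : (forall w, dot x w = Phi u v w) -> x = cross u v.
Proof.
move=> xP; apply/matrixP => k j; rewrite (ord1 j) mxE -xP /dot (bigD1 k) //=.
rewrite mxE !eqxx mulr1 big1 ?addr0 // => i /negPf ik.
by rewrite mxE ik mulr0.
Qed.

End G2Vidinli.

(* f is an isomorphism of the (non-associative) K-algebras (A, mulA), (B, mulB). *)
Definition alg_iso (K : pzRingType) (A B : lmodType K)
    (mulA : A -> A -> A) (mulB : B -> B -> B) (f : A -> B) : Prop :=
  [/\ linear f, bijective f & forall a b, f (mulA a b) = mulB (f a) (f b)].

(* Main.v *)
Require Import Defs.
From HB Require Import structures.
From mathcomp Require Import all_boot all_order all_algebra.
From mathcomp Require Import reals ring lra.

Set Implicit Arguments.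
Unset Strict Implicit.
Unset Printing Implicit Defensive.

Import Order.TTheory GRing.Theory Num.Theory.
Local Open Scope ring_scope.

(** The theorem combines two facts: G_2 acts transitively on S^6, and an
    invertible matrix that preserves the 3-form Phi also preserves the inner
    product. Granted the second, g transports the product of V_{7,p} to that of
    V_{7,gp} term by term, since <p, a x b> = Phi(a, b, p).

    Transitivity. For orthonormal u, v, the span V of u, v and u x v is closed
    under the cross product, and Phi vanishes on V^perp
    (Phi_coassociative): on V^perp the operators J_u = u x _, J_v, J_w with
    w = u x v satisfy J_u J_v = - J_w = - J_v J_u, and each can be moved from
    one argument of Phi to another (Phi_cross_shift); moving J_u and J_v in
    turn reverses their order, so Phi(J_w x, y, z) = - Phi(J_w x, y, z). So in
    the decomposition R^7 = V + V^perp only the terms of Phi with an even number of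
    arguments in V^perp survive, and the involution equal to 1 on V and to -1 on
    V^perp lies in G_2. Given unit vectors p and q, this involution exchanges
    them as soon as p + q is in V and p - q is orthogonal to V; such a V is
    spanned by a unit vector m along p + q (any unit vector orthogonal to p when
    q = - p), a unit vector v orthogonal to m,
    p - q and m x (p - q), and m x v.

    Orthogonality. Let A_u be the skew matrix of u x _. The double cross product
    formula A_u^2 = u u^T - |u|^2 I yields
    det(A_u + a u^T)^2 = <u, a>^2 |u|^12 (sqr_det_cross_mxD). If g preserves Phi
    then g^T A_{gu} g = A_u, and comparing the determinants of suitable rank one
    perturbations of both sides leaves |det g| |gu|^2 = |u|^2 (G2_dot_det).
    Hence |det g| g^T g = I, so |det g|^9 = 1 and g is orthogonal. *)

Lemma mulmx_ext (K : pzRingType) m n (A B : 'M[K]_(m, n)) :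
  (forall x : 'cV_n, A *m x = B *m x) -> A = B.
Proof.
move=> AB; apply/matrixP => i j; have /matrixP/(_ i 0) := AB (delta_mx j 0).
by rewrite -!colE !mxE.
Qed.

(** Both sides are the determinant of the block matrix (1, -b; c^T, 1), reduced
    to triangular form by clearing either of the off-diagonal blocks. *)
Lemma det_1D_rank1 (K : comNzRingType) n (b c : 'cV[K]_n) :
  \det (1%:M + b *m c^T) = 1 + (c^T *m b) 0 0.
Proof.
pose M : 'M[K]_(n + 1) := block_mx 1%:M (- b) c^T 1%:M.
have M1 : M *m block_mx 1%:M b 0 1%:M = block_mx 1%:M 0 c^T (1%:M + c^T *m b).
  by rewrite mulmx_block !mulmx1 !mul1mx !mulmx0 !addr0 subrr
     (addrC (c^T *m b)).
have M2 : block_mx 1%:M b 0 1%:M *m M = block_mx (1%:M + b *m c^T) 0 c^T 1%:M.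
  by rewrite mulmx_block !mulmx1 !mul1mx !mul0mx !add0r addNr.
have := congr1 determinant M1; rewrite -/(determinant _) det_mulmx.
have := congr1 determinant M2; rewrite -/(determinant _) det_mulmx.
rewrite det_ublock !det_lblock !det1 !mul1r !mulr1 => -> ->.
by rewrite det_mx11 !mxE eqxx.
Qed.

(** * The cross product of R^7 *)

Section CrossProduct.
Variable R : realType.
Implicit Types (a b c u v w x y z : 'cV[R]_7).

Lemma dotE u v : dot u v =
  omega 1 u * omega 1 v + omega 2 u * omega 2 v + omega 3 u * omega 3 v +
  omega 4 u * omega 4 v + omega 5 u * omega 5 v + omega 6 u * omega 6 v +
  omega 7 u * omega 7 v.
Proof.
have e (i : 'I_7) k :
    k = i :> nat -> u i 0 * v i 0 = omega k.+1 u * omega k.+1 v.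
  by move=> ->; rewrite /omega /= inord_val.
rewrite /dot !big_ord_recl big_ord0.
rewrite (e _ 0%N) // (e _ 1%N) // (e _ 2%N) // (e _ 3%N) // (e _ 4%N) //.
rewrite (e _ 5%N) // (e _ 6%N) //; ring.
Qed.

Lemma omega_delta i j : (0 < i <= 7)%N -> (0 < j <= 7)%N ->
  omega i (delta_mx (inord j.-1) 0 : 'cV[R]_7) = (i == j)%:R.
Proof.
case: i j => [|i] [|j] //= ilt jlt.
by rewrite /omega /= mxE andbT -val_eqE /= !inordK.
Qed.

Lemma omega_cross u v :
  (omega 1 (cross u v) = omega 2 u * omega 3 v - omega 3 u * omega 2 v
     + omega 4 u * omega 5 v - omega 5 u * omega 4 v
     + omega 6 u * omega 7 v - omega 7 u * omega 6 v) *
  (omega 2 (cross u v) = omega 3 u * omega 1 v - omega 1 u * omega 3 v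
     + omega 4 u * omega 6 v - omega 6 u * omega 4 v
     - omega 5 u * omega 7 v + omega 7 u * omega 5 v) *
  (omega 3 (cross u v) = omega 1 u * omega 2 v - omega 2 u * omega 1 v
     - omega 4 u * omega 7 v + omega 7 u * omega 4 v
     - omega 5 u * omega 6 v + omega 6 u * omega 5 v) *
  (omega 4 (cross u v) = omega 5 u * omega 1 v - omega 1 u * omega 5 v
     + omega 6 u * omega 2 v - omega 2 u * omega 6 v
     - omega 7 u * omega 3 v + omega 3 u * omega 7 v) *
  (omega 5 (cross u v) = omega 1 u * omega 4 v - omega 4 u * omega 1 v
     - omega 7 u * omega 2 v + omega 2 u * omega 7 v
     - omega 6 u * omega 3 v + omega 3 u * omega 6 v) *
  (omega 6 (cross u v) = omega 7 u * omega 1 v - omega 1 u * omega 7 v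
     + omega 2 u * omega 4 v - omega 4 u * omega 2 v
     - omega 3 u * omega 5 v + omega 5 u * omega 3 v) *
  (omega 7 (cross u v) = omega 1 u * omega 6 v - omega 6 u * omega 1 v
     - omega 2 u * omega 5 v + omega 5 u * omega 2 v
     - omega 3 u * omega 4 v + omega 4 u * omega 3 v).
Proof.
have e k : omega k (cross u v) = Phi u v (delta_mx (inord k.-1) 0).
  by rewrite /omega mxE.
by do !split; rewrite e /Phi !omega3E !omega_delta //=; ring.
Qed.

Lemma dotC u v : dot u v = dot v u.
Proof. by rewrite !dotE; ring. Qed.

Lemma Phi_cycle u v w : Phi u v w = Phi v w u.
Proof. by rewrite /Phi !omega3E; ring. Qed.

Lemma Phi_swap u v w : Phi v u w = - Phi u v w.
Proof. by rewrite /Phi !omega3E; ring. Qed.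

(** The polarized form of u x (u x c) = <u, c> u - |u|^2 c, the identity that
    encodes the octonionic norm being multiplicative. It is the only property
    of the cross product, beyond Phi being alternating, that is checked in
    coordinates. *)
Lemma Phi_double_cross a b c x :
  Phi a (cross b c) x + Phi b (cross a c) x =
  dot a c * dot b x + dot b c * dot a x - 2 * dot a b * dot c x.
Proof.
by rewrite /Phi !omega3E !omega_cross !dotE; ring.
Qed.

Lemma dotDl u v w : dot (u + v) w = dot u w + dot v w.
Proof. by rewrite !dotE /omega !mxE; ring. Qed.

Lemma dotZl k u w : dot (k *: u) w = k * dot u w.
Proof. by rewrite !dotE /omega !mxE; ring. Qed.

Lemma dotDr u v w : dot w (u + v) = dot w u + dot w v.
Proof. by rewrite !(dotC w) dotDl. Qed.

Lemma dotZr k u w : dot w (k *: u) = k * dot w u.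
Proof. by rewrite !(dotC w) dotZl. Qed.

Lemma dotNl u w : dot (- u) w = - dot u w.
Proof. by rewrite -scaleN1r dotZl mulN1r. Qed.

Lemma dotNr u w : dot w (- u) = - dot w u.
Proof. by rewrite dotC dotNl dotC. Qed.

Lemma dot_delta u i : dot u (delta_mx i 0) = u i 0.
Proof.
rewrite /dot (bigD1 i) //= mxE !eqxx mulr1 big1 ?addr0 // => j /negPf ji.
by rewrite mxE ji mulr0.
Qed.

Lemma dot_inj u v : (forall w, dot u w = dot v w) -> u = v.
Proof. by move=> uv; apply/colP => i; rewrite -!dot_delta uv. Qed.

Lemma dot_ge0 u : 0 <= dot u u.
Proof. by apply: sumr_ge0 => i _; rewrite -expr2 sqr_ge0. Qed.

Lemma dot_eq0 u : (dot u u == 0) = (u == 0).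
Proof.
apply/eqP/eqP => [/psumr_eq0P uu|->]; last first.
  by rewrite /dot big1 // => i _; rewrite mxE mul0r.
apply/colP => i; have /eqP := uu (fun j _ => sqr_ge0 (u j 0)) i isT.
by rewrite mxE -expr2 sqrf_eq0 => /eqP.
Qed.

Lemma dot_gt0 u : u != 0 -> 0 < dot u u.
Proof. by move=> u0; rewrite lt_def dot_ge0 dot_eq0 u0. Qed.

Lemma PhiDr u v x y : Phi u v (x + y) = Phi u v x + Phi u v y.
Proof. exact: linearD. Qed.

Lemma PhiZr u v k x : Phi u v (k *: x) = k * Phi u v x.
Proof. exact: linearZ. Qed.

Lemma PhiDl u v x y : Phi (x + y) u v = Phi x u v + Phi y u v.
Proof. by rewrite !(Phi_cycle _ u v) PhiDr. Qed.

Lemma PhiZl u v k x : Phi (k *: x) u v = k * Phi x u v.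
Proof. by rewrite !(Phi_cycle _ u v) PhiZr. Qed.

Lemma PhiDm u v x y : Phi u (x + y) v = Phi u x v + Phi u y v.
Proof. by rewrite !(Phi_cycle u) PhiDl. Qed.

Lemma PhiZm u v k x : Phi u (k *: x) v = k * Phi u x v.
Proof. by rewrite !(Phi_cycle u) PhiZl. Qed.

Lemma Phi_same u w : Phi u u w = 0.
Proof. by have := Phi_swap u u w; lra. Qed.

Lemma cross_anti u v : cross u v = - cross v u.
Proof. by apply: dot_inj => w; rewrite dotNl !dot_cross Phi_swap. Qed.

Lemma crossNr u v : cross u (- v) = - cross u v.
Proof.
by apply: dot_inj => w; rewrite dotNl !dot_cross -scaleN1r PhiZm mulN1r.
Qed.

Lemma double_cross a b c :
  cross a (cross b c) + cross b (cross a c) =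
  dot a c *: b + dot b c *: a - (2 * dot a b) *: c.
Proof.
apply: dot_inj => x.
by rewrite !dotDl dotNl !dotZl !dot_cross Phi_double_cross.
Qed.

Lemma cross_cross a c :
  cross a (cross a c) = dot a c *: a - dot a a *: c.
Proof.
have := double_cross a a c.
rewrite -!mulr2n -scaler_nat -[in RHS]scaler_nat -scalerA -scalerBr.
by move/(scalerI _); apply; rewrite pnatr_eq0.
Qed.

(** On the hyperplane orthogonal to u, polarizing the double cross product
    gives y x (u x x) = - u x (y x x) up to a multiple of u, and u x _ is
    skew. *)
Lemma Phi_cross_shift u x y z :
  dot u x = 0 -> dot u y = 0 -> dot u z = 0 ->
  Phi (cross u x) y z = Phi x y (cross u z).
Proof.
move=> ux uy uz.
have := Phi_double_cross y u x z; rewrite ux uz (dotC y u) uy.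
have -> : Phi u (cross y x) z = Phi x y (cross u z).
  rewrite Phi_cycle Phi_cycle Phi_swap -dot_cross dotC dot_cross.
  by rewrite Phi_swap opprK.
by rewrite (Phi_swap y (cross u x)) => H; lra.
Qed.

(** Three linear conditions leave room in dimension 7. *)
Lemma exists_unit_orthogonal a b c : exists v,
  [/\ dot v v = 1, dot v a = 0, dot v b = 0 & dot v c = 0].
Proof.
pose A : 'M[R]_(7, 1 + 1 + 1) := row_mx (row_mx a b) c.
have kA0 : kermx A != 0.
  rewrite -mxrank_eq0 mxrank_ker -lt0n subn_gt0.
  exact: leq_ltn_trans (rank_leq_col A) _.
pose r := nz_row (kermx A); pose v0 := r^T.
have r0 : r != 0 by rewrite nz_row_eq0.
have : r *m A = 0 by apply/sub_kermxP/nz_row_sub.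
rewrite !mul_mx_row -!row_mx0 => /eq_row_mx[/eq_row_mx[ra rb] rc].
have orth x : r *m x = 0 -> dot v0 x = 0.
  move=> /matrixP/(_ 0 0); rewrite !mxE => rx; rewrite -[RHS]rx.
  by apply: eq_bigr => i _; rewrite mxE.
have v0_gt0 : 0 < dot v0 v0.
  by apply: dot_gt0; rewrite -(inj_eq trmx_inj) trmxK trmx0.
exists ((Num.sqrt (dot v0 v0))^-1 *: v0).
split; rewrite !dotZl; [|by rewrite (orth _ ra) mulr0
  |by rewrite (orth _ rb) mulr0|by rewrite (orth _ rc) mulr0].
rewrite dotZr mulrA -invfM -expr2 sqr_sqrtr ?ltW // mulVf // gt_eqF //.
Qed.

(** * Involutions in G_2 and transitivity on the sphere *)

Section AssociativeReflection.
Variables u v : 'cV[R]_7.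
Hypotheses (uu : dot u u = 1) (vv : dot v v = 1) (uv : dot u v = 0).
Let w := cross u v.

Let uw : dot u w = 0.
Proof. by rewrite dotC dot_cross Phi_cycle Phi_cycle Phi_same. Qed.

Let vw : dot v w = 0.
Proof. by rewrite dotC dot_cross Phi_cycle Phi_same. Qed.

Let vu : dot v u = 0. Proof. by rewrite dotC. Qed.
Let wu : dot w u = 0. Proof. by rewrite dotC. Qed.
Let wv : dot w v = 0. Proof. by rewrite dotC. Qed.

Let cross_uw : cross u w = - v.
Proof. by rewrite /w cross_cross uu uv scale0r sub0r scale1r. Qed.

Let cross_vw : cross v w = u.
Proof.
rewrite /w (cross_anti u) crossNr cross_cross vv vu scale0r sub0r opprK.
by rewrite scale1r.
Qed.

Let ww : dot w w = 1.
Proof. by rewrite {1}/w dot_cross Phi_cycle -dot_cross cross_vw. Qed.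

(** The orthogonal complement of span(u, v, u x v). That span is an associative
    3-plane (it generates a quaternion subalgebra of the octonions); its
    complement is called coassociative. *)
Definition coassociative x := [/\ dot u x = 0, dot v x = 0 & dot w x = 0].

Lemma coassociative_cross x : coassociative x ->
  coassociative (cross u x) /\ coassociative (cross v x).
Proof.
case=> ux vx wx.
have adj a b : dot b (cross a x) = - dot (cross a b) x.
  by rewrite dotC !dot_cross Phi_cycle Phi_cycle Phi_swap Phi_cycle Phi_cycle.
have self a : dot a (cross a x) = 0.
  by rewrite dotC dot_cross Phi_cycle Phi_cycle Phi_same.
split; split; rewrite ?self // adj ?cross_uw ?cross_vw.
- by rewrite wx oppr0.
- by rewrite dotNl vx !oppr0.
- by rewrite cross_anti dotNl wx !oppr0.
- by rewrite ux oppr0.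
Qed.

(** Among pairwise orthogonal vectors the triple product a x (b x c) is
    alternating, by polarization. Hence V acts on V^perp as the imaginary
    quaternions do. *)
Lemma cross_cross_coassociative x : coassociative x ->
  cross u (cross v x) = - cross w x /\ cross v (cross u x) = cross w x.
Proof.
case=> ux vx wx.
have := double_cross u v x; rewrite ux vx uv mulr0 !scale0r !addr0 subr0.
have := double_cross x u v.
rewrite (dotC x v) vx (dotC x u) ux uv mulr0 !scale0r.
rewrite !addr0 subr0 -/w (cross_anti x w) (cross_anti x v) crossNr => e1 e2.
have e : cross u (cross v x) = - cross w x.
  by apply/esym/eqP; rewrite -subr_eq0 e1.
by split=> //; apply/eqP; rewrite -subr_eq0 addrC -e e2.
Qed.

(** Moving J_u and then J_v from the first argument to the last gives
    Phi(J_u J_v x, y, z) = Phi(x, y, J_v J_u z), so J_w would move with a change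
    of sign, whereas it moves without one. Hence Phi(J_w x, y, z) = 0, and J_w
    is onto V^perp because its square is -1 there. *)
Lemma Phi_coassociative x y z :
  coassociative x -> coassociative y -> coassociative z -> Phi x y z = 0.
Proof.
have shift_w x' : coassociative x' -> coassociative y -> coassociative z ->
    Phi (cross w x') y z = 0.
  move=> cx cy cz; have [_ [ux2 _ _]] := coassociative_cross cx.
  have [[_ vz2 _] _] := coassociative_cross cz.
  have [ex _] := cross_cross_coassociative cx.
  have [_ ez] := cross_cross_coassociative cz.
  case: cx cy cz => ux vx wx [uy vy wy] [uz vz wz].
  have := Phi_cross_shift ux2 uy uz.
  rewrite (Phi_cross_shift vx vy vz2) ez ex -(Phi_cross_shift wx wy wz).
  by rewrite -scaleN1r PhiZl; lra.
move=> cx cy cz.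
have cwx : coassociative (cross w x).
  have [_ <-] := cross_cross_coassociative cx.
  by have [/coassociative_cross[]] := coassociative_cross cx.
have := shift_w _ cwx cy cz; rewrite cross_cross ww scale1r.
case: cx => _ _ ->; rewrite scale0r sub0r -scaleN1r PhiZl; lra.
Qed.

Definition associative_proj x := dot u x *: u + dot v x *: v + dot w x *: w.

Definition associative_refl : 'M[R]_7 :=
  2 *: (u *m u^T + v *m v^T + w *m w^T) - 1%:M.

Lemma outer_mulmx a b x : (a *m b^T) *m x = dot b x *: a.
Proof.
rewrite -mulmxA; apply/colP => i; rewrite !mxE big_ord1 mulrC mxE.
by congr (_ * _); apply: eq_bigr => j _; rewrite mxE.
Qed.

Lemma associative_reflE x : associative_refl *m x = 2 *: associative_proj x - x.
Proof. by rewrite mulmxBl mul1mx -scalemxAl !mulmxDl !outer_mulmx. Qed.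

Lemma associative_proj_coassociative x : coassociative (x - associative_proj x).
Proof.
split; rewrite /associative_proj dotDr dotNr !dotDr !dotZr ?uu ?uv ?uw ?vu ?vv
  ?vw ?wu ?wv ?ww; ring.
Qed.

(** The span of u, v, w is closed under the cross product, which therefore
    maps two projections to a vector orthogonal to z. *)
Lemma Phi_associative_proj x y z :
  coassociative z -> Phi (associative_proj x) (associative_proj y) z = 0.
Proof.
case=> uz vz wz.
have Puv : Phi u v z = 0 by rewrite -dot_cross.
have Pvw : Phi v w z = 0 by rewrite -dot_cross cross_vw.
have Puw : Phi u w z = 0 by rewrite -dot_cross cross_uw dotNl vz oppr0.
rewrite /associative_proj !PhiDl !PhiDm !PhiZl !PhiZm !Phi_same.
rewrite (Phi_swap u v) (Phi_swap v w) (Phi_swap u w) Puv Pvw Puw; ring.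
Qed.

(** Splitting each argument along V + V^perp, the reflection changes only the
    sign of the terms of Phi with one or three arguments in V^perp, and these
    vanish. *)
Lemma G2_associative_refl : G2 associative_refl.
Proof.
split.
  suff : associative_refl *m associative_refl = 1%:M by case/mulmx1_unit.
  apply: mulmx_ext => x; rewrite -mulmxA mul1mx.
  set x1 := x - associative_proj x.
  have xE : associative_refl *m x = x - 2 *: x1.
    rewrite associative_reflE /x1; move: (associative_proj x) => t.
    by apply/colP => i; rewrite !mxE; ring.
  have x1E : associative_refl *m x1 = - x1.
    case: (associative_proj_coassociative x); rewrite -/x1 => ux vx wx.
    by rewrite associative_reflE /associative_proj ux vx wx !scale0r !addr0
       scaler0 sub0r.
  by rewrite xE mulmxBr xE -scalemxAr x1E scalerN opprK subrK.
move=> x y z; rewrite !associative_reflE.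
have split_refl t : exists2 t0, (exists t', t0 = associative_proj t') &
  exists2 t1, coassociative t1 &
    t = t0 + t1 /\ 2 *: associative_proj t - t = t0 - t1.
  exists (associative_proj t); first by exists t.
  exists (t - associative_proj t); first exact: associative_proj_coassociative.
  by split; apply/colP => i; rewrite !mxE; ring.
have [x0 [x' x0E] [x1 cx [xE ->]]] := split_refl x.
have [y0 [y' y0E] [y1 cy [yE ->]]] := split_refl y.
have [z0 [z' z0E] [z1 cz [zE ->]]] := split_refl z.
have P1 : Phi x0 y0 z1 = 0 by rewrite x0E y0E Phi_associative_proj.
have P2 : Phi y0 z0 x1 = 0 by rewrite y0E z0E Phi_associative_proj.
have P3 : Phi z0 x0 y1 = 0 by rewrite z0E x0E Phi_associative_proj.
rewrite Phi_cycle Phi_cycle in P2; rewrite Phi_cycle in P3.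
rewrite xE yE zE -!scaleN1r !PhiDl !PhiDm !PhiDr !PhiZl !PhiZm !PhiZr P1 P2 P3.
by rewrite (Phi_coassociative cx cy cz); ring.
Qed.

End AssociativeReflection.

Lemma G2_transitive p q :
  S6 p -> S6 q -> exists g : 'M[R]_7, G2 g /\ g *m p = q.
Proof.
rewrite /S6 => pp qq; pose d := p - q; pose s := p + q.
have sd : dot s d = 0.
  by rewrite /s /d !(dotDl, dotDr, dotNr) pp qq (dotC q); ring.
(* When q = - p, any unit m orthogonal to p - q will do, with k = 0. *)
have [m [k [mm md sE]]] :
    exists m, exists k, [/\ dot m m = 1, dot m d = 0 & s = k *: m].
  have [s0|s0] := eqVneq s 0.
    have [m [mm md _ _]] := exists_unit_orthogonal d 0 0.
    by exists m, 0; rewrite s0 scale0r.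
  have r0 := dot_gt0 s0; set r := Num.sqrt (dot s s).
  have rr : r ^+ 2 = dot s s by rewrite sqr_sqrtr ?ltW.
  have r_neq0 : r != 0 by rewrite sqrtr_eq0 -ltNge.
  exists (r^-1 *: s), r; rewrite !dotZl dotZr sd mulr0 -rr scalerA divff //.
  by rewrite scale1r; split=> //; field.
(* The condition <v, m x d> = 0 makes m x v orthogonal to d. *)
have [v [vv vm vd vmd]] := exists_unit_orthogonal m d (cross m d).
have mv : dot m v = 0 by rewrite dotC.
exists (associative_refl m v); split; first exact: G2_associative_refl.
have gd : associative_refl m v *m d = - d.
  have wd : dot (cross m v) d = 0.
    by rewrite dot_cross Phi_swap Phi_cycle -dot_cross dotC vmd oppr0.
  by rewrite associative_reflE /associative_proj md vd wd !scale0r !addr0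
    scaler0 sub0r.
have gs : associative_refl m v *m s = s.
  have wm : dot (cross m v) m = 0.
    by rewrite dot_cross Phi_cycle Phi_cycle Phi_same.
  rewrite associative_reflE /associative_proj sE !dotZr mm vm wm !mulr0.
  by rewrite !scale0r !addr0 mulr1 scaler_nat mulr2n addrK.
have pE : p = 2^-1 *: (s + d).
  by apply/colP => i; rewrite /s /d !mxE; field.
rewrite pE -scalemxAr mulmxDr gs gd.
by apply/colP => i; rewrite /s /d !mxE; field.
Qed.

(** * Matrices preserving Phi are orthogonal *)

Lemma mul_tr_dot u v : u^T *m v = (dot u v)%:M.
Proof.
apply/matrixP => i j; rewrite !ord1 !mxE eqxx mulr1n.
by apply: eq_bigr => k _; rewrite mxE.
Qed.

Lemma dot_mulmx (g : 'M[R]_7) u v : dot (g *m u) v = dot u (g^T *m v).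
Proof.
have E a b : dot a b = (a^T *m b) 0 0 by rewrite mul_tr_dot mxE eqxx.
by rewrite !E trmx_mul mulmxA.
Qed.

Definition cross_mx u : 'M[R]_7 :=
  \matrix_(i, j) Phi u (delta_mx j 0) (delta_mx i 0).

Lemma mul_cross_mx u x : cross_mx u *m x = cross u x.
Proof.
apply/colP => i; have swap a b : Phi u a b = - Phi u b a.
  by rewrite Phi_cycle Phi_swap -Phi_cycle.
rewrite !mxE swap -dot_cross /dot -sumrN; apply: eq_bigr => j _.
by rewrite !mxE swap mulNr.
Qed.

Lemma tr_cross_mx u : (cross_mx u)^T = - cross_mx u.
Proof.
by apply/matrixP => i j; rewrite !mxE Phi_cycle Phi_swap -Phi_cycle.
Qed.

Lemma sqr_cross_mx u :
  cross_mx u *m cross_mx u = u *m u^T - (dot u u)%:M.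
Proof.
apply: mulmx_ext => x; rewrite mulmxBl mul_scalar_mx outer_mulmx -mulmxA.
by rewrite !mul_cross_mx cross_cross.
Qed.

Lemma cross_mx_kernel u : cross_mx u *m u = 0.
Proof.
rewrite mul_cross_mx; apply: dot_inj => w; rewrite dot_cross Phi_same.
by rewrite /dot big1 // => i _; rewrite mxE mul0r.
Qed.

Lemma cross_mx_cokernel u : u^T *m cross_mx u = 0.
Proof.
by apply: trmx_inj; rewrite trmx_mul trmxK tr_cross_mx mulNmx cross_mx_kernel
  oppr0 trmx0.
Qed.

(** A_u + a u^T = (1 + |u|^-2 (a - u) u^T) N with N = A_u + u u^T, because
    u^T A_u = 0; and N N^T is a multiple of the identity plus a multiple of
    u u^T. Squaring makes it unnecessary to know the sign of det N. *)
Lemma sqr_det_cross_mxD u a : u != 0 ->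
  \det (cross_mx u + a *m u^T) ^+ 2 = dot u a ^+ 2 * dot u u ^+ 6.
Proof.
move=> u0; set r := dot u u; have r0 : r != 0 by rewrite dot_eq0.
set N := cross_mx u + u *m u^T.
have NN : N *m N^T = r%:M *m (1%:M + ((r - 1) / r *: u) *m u^T).
  rewrite /N linearD /= tr_cross_mx trmx_mul trmxK mulmxDl !mulmxDr !mulmxN.
  rewrite sqr_cross_mx (mulmxA _ u) cross_mx_kernel mul0mx addr0.
  rewrite -(mulmxA u _ (cross_mx u)) cross_mx_cokernel mulmx0 oppr0 add0r.
  rewrite mulmx1 mul_scalar_mx (mulmxA (u *m u^T)) -(mulmxA u _ u) mul_tr_dot.
  rewrite -/r mul_mx_scalar -!scalemxAl.
  move: (u *m u^T) => U.
  by apply/matrixP => i j; rewrite !mxE; field.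
have detN : \det N ^+ 2 = r ^+ 8.
  rewrite expr2 -{2}(det_tr N) -det_mulmx NN det_mulmx det_scalar det_1D_rank1.
  by rewrite mul_tr_dot mxE eqxx mulr1n dotZr -/r; field.
have -> : cross_mx u + a *m u^T = (1%:M + (r^-1 *: (a - u)) *m u^T) *m N.
  rewrite mulmxDl mul1mx -(mulmxA _ u^T) /N mulmxDr cross_mx_cokernel add0r.
  rewrite (mulmxA u^T) mul_tr_dot -/r mul_scalar_mx -scalemxAl -scalemxAr.
  by rewrite scalerA mulVf // scale1r mulmxBl -addrA (addrC (u *m u^T)) subrK.
rewrite det_mulmx exprMn detN det_1D_rank1 mul_tr_dot mxE eqxx mulr1n.
by rewrite dotZr dotDr dotNr -/r; field.
Qed.

Section Orthogonality.
Variable g : 'M[R]_7.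
Hypothesis gG2 : G2 g.

Lemma G2_cross_mx u : g^T *m cross_mx (g *m u) *m g = cross_mx u.
Proof.
have [_ gPhi] := gG2; apply: mulmx_ext => x; apply: dot_inj => y.
rewrite -!mulmxA dotC -dot_mulmx dotC !mul_cross_mx !dot_cross.
exact: gPhi.
Qed.

(** With a = (g^T)^-1 u, congruence by g carries A_{gu} + a (gu)^T to
    A_u + u (g^T g u)^T, which is up to sign the transpose of
    A_u - (g^T g u) u^T. Both squared determinants are known, and
    <u, g^T g u> = |gu|^2, which gives
    (det g)^4 |u|^4 |gu|^12 = |gu|^4 |u|^12. *)
Lemma G2_dot_det u : `|\det g| * dot (g *m u) (g *m u) = dot u u.
Proof.
have [gU _] := gG2.
have [->|u0] := eqVneq u 0.
  by rewrite mulmx0 /dot big1 ?mulr0 // => i _; rewrite mxE mul0r.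
have gu0 : g *m u != 0.
  by apply: contraNneq u0 => gu; rewrite -(mulKmx gU u) gu mulmx0.
set r := dot u u; set r' := dot (g *m u) (g *m u).
have r_gt0 : 0 < r by exact: dot_gt0.
have r'_gt0 : 0 < r' by exact: dot_gt0.
set a := invmx g^T *m u; set c := g^T *m (g *m u).
have ga : g^T *m a = u by rewrite mulKVmx // unitmx_tr.
have E : g^T *m (cross_mx (g *m u) + a *m (g *m u)^T) *m g =
         - (cross_mx u + (- c) *m u^T)^T.
  rewrite mulmxDr mulmxDl G2_cross_mx mulmxA ga -mulmxA linearD /= tr_cross_mx.
  rewrite mulNmx linearN /= (trmx_mul c) trmxK -opprD opprK.
  by rewrite /c (trmx_mul g^T) trmxK.
have := congr1 (fun M => \det M ^+ 2) E.
rewrite !det_mulmx det_tr -scaleN1r detZ det_tr !exprMn !sqr_det_cross_mxD //.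
rewrite dot_mulmx ga dotNr -dot_mulmx -/r -/r' => D.
have {}D : ((\det g) ^+ 2 * r' ^+ 2) ^+ 2 = (r ^+ 2) ^+ 2.
  have k0 : r ^+ 2 * r' ^+ 2 != 0 by rewrite mulf_neq0 // expf_neq0 // gt_eqF.
  by apply: (mulfI k0); ring: D.
have sqr_inj (s t : R) : 0 <= s -> 0 <= t -> s ^+ 2 = t ^+ 2 -> s = t.
  by move=> s0 t0 /eqP; rewrite eqrXn2 // => /eqP.
apply: (sqr_inj); rewrite ?mulr_ge0 ?normr_ge0 ?(ltW r_gt0) ?(ltW r'_gt0) //.
rewrite exprMn real_normK ?num_real //.
by apply: sqr_inj => //; first (apply: mulr_ge0); exact: sqr_ge0.
Qed.

(** Polarizing the previous identity gives |det g| g^T g = 1; its determinant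
    is |det g|^7 (det g)^2 = |det g|^9. *)
Lemma G2_dot u v : dot (g *m u) (g *m v) = dot u v.
Proof.
set k := `|\det g|.
have kdot x y : k * dot (g *m x) (g *m y) = dot x y.
  have := G2_dot_det (x + y); have := G2_dot_det x; have := G2_dot_det y.
  rewrite mulmxDr !dotDl !dotDr (dotC (g *m y)) (dotC y) -/k.
  by rewrite !mulrDr => -> ->; lra.
have kgg : k *: (g^T *m g) = 1%:M.
  apply: mulmx_ext => x; apply: dot_inj => y.
  by rewrite -scalemxAl dotZl -mulmxA dotC -dot_mulmx dotC kdot mul1mx.
have := congr1 determinant kgg.
rewrite detZ det_mulmx det_tr det1 -expr2 -real_normK ?num_real // -/k -exprD.
move=> /eqP; rewrite pexpr_eq1 ?normr_ge0 // => /eqP k1.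
by rewrite -[LHS]mul1r -k1 kdot.
Qed.

Lemma G2_alg_iso p q : g *m p = q ->
  alg_iso (vidinli p) (vidinli q) (fun x : 'cV[R]_7 => g *m x).
Proof.
have [gU gPhi] := gG2.
move=> <-; split.
- by move=> k x y; rewrite mulmxDr -scalemxAr.
- by exists (mulmx (invmx g)) => x; rewrite (mulKmx, mulKVmx).
move=> a b; rewrite /vidinli !mulmxDr mulmxN -!scalemxAr !G2_dot.
by rewrite (dotC p (cross _ _)) (dotC _ (cross _ _)) !dot_cross gPhi.
Qed.

End Orthogonality.

End CrossProduct.

Theorem proposition3p15 (R : realType) :
  (forall p q : 'cV[R]_7, S6 p -> S6 q ->
     (exists g : 'M[R]_7, G2 g /\ g *m p = q) /\
     (forall g : 'M[R]_7, G2 g -> g *m p = q ->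
        alg_iso (vidinli p) (vidinli q) (fun x : 'cV[R]_7 => g *m x))) /\
  (forall p q : 'cV[R]_7, S6 p -> S6 q ->
     exists f : 'cV[R]_7 -> 'cV[R]_7, alg_iso (vidinli p) (vidinli q) f).
Proof.
split=> p q pS qS.
  by split; [exact: G2_transitive|move=> g gG2; exact: G2_alg_iso].
have [g [gG2 gp]] := G2_transitive pS qS.
by exists (fun x => g *m x); apply: G2_alg_iso.
Qed.
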